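(* Let $S\subseteq[m_1]\times\dots\times[m_k]$ be a set of $k$-tuples, let $j\in[k]$, and choose a $j$-coordinate split of $S$, given by an index set $a\subseteq[k]$ with $j\in a$. Let $S_1$ and $S_2$ be the sets of tuples resulting from this $j$-coordinate split. Then $S$ is a coordinate toric fiber product according to this $j$-coordinate split if and only if whenever $s_1=A_1+_j^{a}B_1$ and $s_2=A_2+_j^{a}B_2$ are elements of $S$ with the same $j$th coordinate, the tuples $s_3=A_1+_j^{a}B_2$ and $s_4=A_2+_j^{a}B_1$ also belong to $S$. Consequently, $S$ is a coordinate toric fiber product if this holds for at least one $j\le k$ and some $j$-coordinate splitting.
   Context: **Splits.** For $s=(i_1,\dots,i_k)$, $j\in[k]$ and $a\subseteq[k]$ with $j\in a$, put $A=(i_\ell)_{\ell\in a}$ and $B=(i_\ell)_{\ell\in([k]\setminus a)\cup\{j\}}$. Write $s=A+_j^{a}B$ and say that $A,B$ form a $j$-coordinate split of $s$ according to $a$. Conversely, given a tuple $A$ indexed by $a$ and a tuple $B$ indexed by $([k]\setminus a)\cup\{j\}$ with the same entry at index $j$, $A+_j^aB$ denotes the $k$-tuple obtained by combining them. Splitting all elements of $S$ with the same $a$ and $j$ gives the sets $S_1=\{A : A+_j^aB\in S \text{ for some }B\}$ and $S_2=\{B : A+_j^aB\in S\text{ for some }A\}$. **Coordinate toric fiber product (cTFP).** $S$ is a cTFP according to this $j$-coordinate split if $S=\{A+_j^aB : A\in S_1,\ B\in S_2,\ A \text{ and } B \text{ have the same entry at index } j\}$. This means that the parametrizing $0/1$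 matrix of the quasi-independence model of $S$ is obtained by gluing the columns of the matrices for $S_1$ and $S_2$ that agree on the block of coordinate $j$. $S$ is a cTFP (of lower-order models) if it is a cTFP according to some $j$-coordinate split in which both $S_1$ and $S_2$ consist of tuples of length less than $k$, i.e. $\{j\}\subsetneq a\subsetneq[k]$. In the final sentence of the claim, ''splitting'' refers to such a split. *)

(* Defs.v *)
From HB Require Import structures.
From mathcomp Require Import all_boot.

Set Implicit Arguments.
Unset Strict Implicit.
Unset Printing Implicit Defensive.

Section CoordinateToricFiberProduct.

(* The ranges [m_i] = {1, ..., m_i} are encoded 0-based as 'I_(m i). *)
Variables (k : nat) (m : 'I_k -> nat).

Definition ktuple := {dffun forall i : 'I_k, 'I_(m i)}.

(* Tuples whose entries are indexed by the elements of a. *)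
Definition tuple_on (a : {set 'I_k}) :=
  {dffun forall i : {i : 'I_k | i \in a}, 'I_(m (val i))}.

Definition entry (a : {set 'I_k}) (A : tuple_on a) (i : 'I_k) (ia : i \in a) :
  'I_(m i) := A (exist _ i ia).

Definition coaset (j : 'I_k) (a : {set 'I_k}) : {set 'I_k} := ~: a :|: [set j].

Lemma coaset_j (j : 'I_k) (a : {set 'I_k}) : j \in coaset j a.
Proof. by rewrite !inE eqxx orbT. Qed.

Lemma coaset_notin (j : 'I_k) (a : {set 'I_k}) (i : 'I_k) :
  i \notin a -> i \in coaset j a.
Proof. by rewrite !inE => ->. Qed.

Definition subtuple (a : {set 'I_k}) (s : ktuple) : tuple_on a :=
  [ffun i : {i : 'I_k | i \in a} => s (val i)].

Section Split.

Variables (j : 'I_k) (a : {set 'I_k}) (ja : j \in a).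

Definition agree (A : tuple_on a) (B : tuple_on (coaset j a)) : bool :=
  entry A ja == entry B (coaset_j j a).

(* A +_j^a B is only meaningful when [agree A B] holds (otherwise the j-th
   entry is the one of A). *)
Definition combine (A : tuple_on a) (B : tuple_on (coaset j a)) : ktuple :=
  [ffun i : 'I_k => match boolP (i \in a) with
                    | AltTrue ia => entry A ia
                    | AltFalse nia => entry B (coaset_notin j nia)
                    end].

(* s = A +_j^a B, A and B being read off from s *)
Definition is_split (s : ktuple) (A : tuple_on a) (B : tuple_on (coaset j a)) :
  Prop := A = subtuple a s /\ B = subtuple (coaset j a) s.

Lemma is_splitP (s : ktuple) (A : tuple_on a) (B : tuple_on (coaset j a)) :
  is_split s A B <-> agree A B /\ s = combine A B.
Proof.
split=> [[-> ->]|[/eqP agAB ->]].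
  split; first by rewrite /agree /entry !ffunE.
  apply/ffunP=> i; rewrite ffunE.
  by case: {-}_ / boolP => ia; rewrite /entry ffunE.
split; apply/ffunP=> -[i ib]; rewrite !ffunE /=.
  case: {-}_ / boolP => [ia|nia]; last by case/negP: (nia).
  by rewrite /entry (bool_irrelevance ia ib).
case: {-}_ / boolP => [ia|nia]; last first.
  by rewrite /entry (bool_irrelevance ib (coaset_notin j nia)).
have ij : i = j by apply/eqP; move: (ib); rewrite !inE ia.
move: ib ia; rewrite {i}ij => jb ja'.
rewrite (bool_irrelevance ja' ja) (bool_irrelevance jb (coaset_j j a)).
by rewrite agAB.
Qed.

Definition split1 (S : {set ktuple}) : {set tuple_on a} :=
  [set A | [exists B, agree A B && (combine A B \in S)]].

Definition split2 (S : {set ktuple}) : {set tuple_on (coaset j a)} :=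
  [set B | [exists A, agree A B && (combine A B \in S)]].

Definition cTFP_at (S : {set ktuple}) : Prop :=
  S = [set combine A B | A in split1 S, B in split2 S & agree A B].

(* A1, B2 and A2, B1 agree at j because s1 and s2 do. *)
Definition exchange (S : {set ktuple}) : Prop :=
  forall (s1 s2 : ktuple) (A1 A2 : tuple_on a) (B1 B2 : tuple_on (coaset j a)),
    is_split s1 A1 B1 -> is_split s2 A2 B2 ->
    s1 \in S -> s2 \in S -> s1 j = s2 j ->
    combine A1 B2 \in S /\ combine A2 B1 \in S.

End Split.

(* The bounds {j} < a < [k] say that both halves have length less than k. *)
Definition cTFP (S : {set ktuple}) : Prop :=
  exists (j : 'I_k) (a : {set 'I_k}) (ja : j \in a),
    [/\ [set j] \proper a, a \proper [set: 'I_k] & cTFP_at ja S].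

End CoordinateToricFiberProduct.

(* Main.v *)
Require Import Defs.
From mathcomp Require Import all_boot.

(** Every element of [S] is glued from its own two halves, so [S] always lies in the set of glued
    tuples; the content is the reverse inclusion. If [A] and [B] agree at [j], then [A] has a
    partner [B'] and [B] a partner [A'] with both combinations in [S]. These share the [j]th
    coordinate, so the exchange property puts [combine A B] in [S]. Conversely, swapping the halves
    of two elements of [S] yields agreeing halves from [split1] and [split2], whose gluing a cTFP
    must contain. [is_splitP] passes between restricting and gluing. *)

Section SplitLemmas.

Variables (k : nat) (m : 'I_k -> nat) (j : 'I_k) (a : {set 'I_k}).
Hypothesis ja : j \in a.
Implicit Types (s : ktuple m) (S : {set ktuple m}).
Implicit Types (A : tuple_on m a) (B : tuple_on m (coaset j a)).

Lemma is_split_combine A B : agree ja A B -> is_split (combine A B) A B.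
Proof. by move=> agAB; apply/(is_splitP ja). Qed.

Lemma is_split_entry1 s A B : is_split s A B -> entry A ja = s j.
Proof. by case=> -> _; rewrite /entry ffunE. Qed.

Lemma is_split_entry2 s A B : is_split s A B -> entry B (coaset_j j a) = s j.
Proof. by case=> _ ->; rewrite /entry ffunE. Qed.

Lemma is_split_mem1 S s A B : is_split s A B -> s \in S -> A \in split1 ja S.
Proof.
by move=> /(is_splitP ja)[agAB ->] sS; rewrite inE; apply/existsP; exists B; apply/andP.
Qed.

Lemma is_split_mem2 S s A B : is_split s A B -> s \in S -> B \in split2 ja S.
Proof.
by move=> /(is_splitP ja)[agAB ->] sS; rewrite inE; apply/existsP; exists A; apply/andP.
Qed.

(** The nontrivial inclusion in the equality that defines a cTFP, isolated for use on swapped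
    halves. *)
Lemma cTFP_at_combine S A B : cTFP_at ja S ->
  A \in split1 ja S -> B \in split2 ja S -> agree ja A B -> combine A B \in S.
Proof.
move=> defS A1 B2 agAB; rewrite defS; apply/imset2P.
by exists A B => //; rewrite inE B2.
Qed.

Lemma cTFP_at_exchange S : cTFP_at ja S <-> exchange j a S.
Proof.
split=> [tfp s1 s2 A1 A2 B1 B2 sp1 sp2 s1S s2S s12|exch].
  split; apply: cTFP_at_combine => //.
  - exact: is_split_mem1 sp1 s1S.
  - exact: is_split_mem2 sp2 s2S.
  - by rewrite /agree (is_split_entry1 _ _ _ sp1) (is_split_entry2 _ _ _ sp2) s12.
  - exact: is_split_mem1 sp2 s2S.
  - exact: is_split_mem2 sp1 s1S.
  - by rewrite /agree (is_split_entry1 _ _ _ sp2) (is_split_entry2 _ _ _ sp1) s12.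
apply/setP=> s; apply/idP/imset2P=> [sS|[A B]].
  (* The inclusion that holds for any [S]: the halves are the restrictions of [s] itself. *)
  have sp : is_split s (subtuple a s) (subtuple (coaset j a) s) by [].
  have [agAB defs] := (is_splitP ja _ _ _).1 sp.
  exists (subtuple a s) (subtuple (coaset j a) s) => //.
    exact: is_split_mem1 sp sS.
  by rewrite inE (is_split_mem2 _ _ _ _ sp sS).
rewrite !inE => /existsP[B' /andP[agAB' S1]].
move=> /andP[/existsP[A' /andP[agA'B S2]] agAB] ->.
(* Exchange is applied to [combine A B'] and [combine A' B], whose outer halves [A] and [B] form the
   wanted tuple. *)
have sp1 := is_split_combine _ _ agAB'; have sp2 := is_split_combine _ _ agA'B.
suff s12 : combine A B' j = combine A' B j by have [] := exch _ _ _ _ _ _ sp1 sp2 S1 S2 s12.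
(* Reading one [j]th coordinate from [A] and the other from [B] turns the goal into
   [agree ja A B]. *)
rewrite -(is_split_entry1 _ _ _ sp1) -(is_split_entry2 _ _ _ sp2).
exact/eqP.
Qed.

End SplitLemmas.

Theorem theorem3p4 (k : nat) (m : 'I_k -> nat) (S : {set ktuple m}) :
  (forall (j : 'I_k) (a : {set 'I_k}) (ja : j \in a),
     cTFP_at ja S <-> exchange j a S) /\
  ((exists (j : 'I_k) (a : {set 'I_k}),
      [/\ j \in a, [set j] \proper a, a \proper [set: 'I_k]
        & exchange j a S]) -> cTFP S).
Proof.
split=> [j a ja|[j [a [ja ja_proper aT exch]]]]; first exact: cTFP_at_exchange.
by exists j, a, ja; split=> //; apply/cTFP_at_exchange.
Qed.
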